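(* Let $d,n$ be positive integers with $d+1\le 2^n$, let $0<\kappa_1\le\kappa_2$ be constants, and let $G\subset\mathbb{R}^d$ be a set all of whose points satisfy $\kappa_1\le\|\boldsymbol{x}\|\le\kappa_2$. Let $F:G\to\mathbb{C}^{2^n}$ be the amplitude encoding $$F(\boldsymbol{x})=|\bar{\boldsymbol{x}}\rangle=\gamma^{-1}(x_1,\dots,x_d,\tilde{x},0,\dots,0)^T,\qquad \tilde{x}=\frac{\|\boldsymbol{x}\|}{1+\|\boldsymbol{x}\|},\quad \gamma=(\|\boldsymbol{x}\|^2+\tilde{x}^2)^{1/2},$$ and let $\bar G=F(G)$, a subset of the unit sphere $\mathbb{S}$ of $\mathbb{C}_2^{\otimes n}\cong\mathbb{C}^{2^n}$. Let $\mu$ be a finite Borel measure on $\bar G$ and let $f:\bar G\to\mathbb{R}$ be an arbitrary square-integrable function on $\bar G$. For $n_s\in\mathbb{N}$, $\boldsymbol{z}_1,\dots,\boldsymbol{z}_{n_s}\in\mathbb{S}$, $\boldsymbol{a}\in\mathbb{R}_+^{n_s}$ (positive entries), $\boldsymbol{c}\in[0,1]^{n_s}$ and $\boldsymbol{\alpha}\in\mathbb{R}^{n_s}$ define $$q_{\boldsymbol{z}_1,\dots,\boldsymbol{z}_{n_s},\boldsymbol{a},\boldsymbol{c},\boldsymbol{\alpha}}(\bar{\boldsymbol{x}})=\sum_{j=1}^{n_s}\alpha_j\,\sigma\big(a_j(|\langle\bar{\boldsymbol{x}}|\boldsymbol{z}_j\rangle|^2-c_j)\big),\qquad \sigma(t)=\frac{1}{1+e^{-t}},$$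 and let $Q(\bar G)$ be the set of all such functions (over all choices of $n_s,\boldsymbol{z}_j,\boldsymbol{a},\boldsymbol{c},\boldsymbol{\alpha}$). Then $Q(\bar G)$ is dense in $L^2(\bar G,\mu)$: for every $\epsilon>0$ there exists $q\in Q(\bar G)$ with $$\int_{\bar G}|q(\bar{\boldsymbol{x}})-f(\bar{\boldsymbol{x}})|^2\,d\mu<\epsilon.$$
   Context: $\langle\bar{\boldsymbol{x}}|\boldsymbol{z}\rangle$ denotes the standard Hermitian inner product on $\mathbb{C}^{2^n}$; $\mathbb{S}$ is the set of unit vectors of $\mathbb{C}^{2^n}$. $L^2(\bar G,\mu)$ is the space of real-valued square-integrable functions on $\bar G$ with respect to $\mu$. *)

(* Defs.v *)
From HB Require Import structures.
From mathcomp Require Import all_boot all_order all_algebra.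
From mathcomp Require Import all_classical all_reals all_analysis.
From mathcomp Require Import complex.

Set Implicit Arguments.
Unset Strict Implicit.
Unset Printing Implicit Defensive.

Import Order.TTheory GRing.Theory Num.Theory.
Local Open Scope classical_set_scope.
Local Open Scope complex_scope.
Local Open Scope ring_scope.

Section Defs.
Variable R : realType.

Definition sqmod (w : R[i]) : R := complex.Re w ^+ 2 + complex.Im w ^+ 2.

Definition rnorm (d : nat) (x : 'rV[R]_d) : R :=
  Num.sqrt (\sum_(i < d) x 0 i ^+ 2).

Definition cvec (N : nat) : Type := 'rV[R[i]]_N.
HB.instance Definition _ (N : nat) := GRing.Zmodule.copy (cvec N) 'rV[R[i]]_N.
HB.instance Definition _ (N : nat) := isPointed.Build (cvec N) 0.

Definition qvec (n : nat) := cvec (2 ^ n).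

Definition cnorm (N : nat) (v : cvec N) : R :=
  Num.sqrt (\sum_(k < N) sqmod (v 0 k)).

Definition braket (N : nat) (x z : cvec N) : R[i] :=
  \sum_(k < N) conjc (x 0 k) * z 0 k.

Definition usphere (N : nat) : set (cvec N) := [set z | cnorm z = 1].

Definition xtilde (d : nat) (x : 'rV[R]_d) : R := rnorm x / (1 + rnorm x).
Definition gammaenc (d : nat) (x : 'rV[R]_d) : R :=
  Num.sqrt (rnorm x ^+ 2 + xtilde x ^+ 2).
Definition amp_enc (d n : nat) (x : 'rV[R]_d) : qvec n :=
  \row_(k < 2 ^ n)
    ((if @insub nat (fun m => (m < d)%N) 'I_d (val k) is Some i then x 0 i
      else if val k == d then xtilde x else 0) / gammaenc x)%:C.

Definition copen (N : nat) (U : set (cvec N)) : Prop :=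
  forall x, U x -> exists2 e : R, 0 < e & forall y, cnorm (y - x) < e -> U y.

Definition trace_opens (N : nat) (A : set (cvec N)) : set (set (cvec N)) :=
  [set A `&` U | U in copen (N:=N)].

(* C^N equipped with the sigma-algebra generated by the relatively open
   subsets of A; its measurable subsets of A are exactly the Borel sets of A *)
Definition borel_on (N : nat) (A : set (cvec N)) :=
  g_sigma_algebraType (trace_opens A).

Definition Gbar (d n : nat) (G : set 'rV[R]_d) : set (qvec n) := @amp_enc d n @` G.
Definition Gspace (d n : nat) (G : set 'rV[R]_d) := borel_on (@Gbar d n G).
Definition GbarS (d n : nat) (G : set 'rV[R]_d) : set (@Gspace d n G) := @Gbar d n G.

Definition sigmoid (t : R) : R := 1 / (1 + expR (- t)).

Definition qfun (N ns : nat) (z : 'I_ns -> cvec N) (a c alpha : 'I_ns -> R)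
  (xbar : cvec N) : R :=
  \sum_(j < ns) alpha j * sigmoid (a j * (sqmod (braket xbar (z j)) - c j)).

Definition Qset (N : nat) : set (cvec N -> R) :=
  [set q | exists ns (z : 'I_ns -> cvec N) (a c alpha : 'I_ns -> R),
     [/\ forall j, usphere (z j), forall j, 0 < a j,
         forall j, 0 <= c j <= 1 & q = qfun z a c alpha]].

End Defs.
Arguments amp_enc {R d} n x.
Arguments Gbar {R d} n G.
Arguments Gspace {R d} n G.
Arguments GbarS {R d} n G.

(* Main.v *)
Require Import Defs.
From HB Require Import structures.
From mathcomp Require Import all_boot all_order all_algebra.
From mathcomp Require Import all_classical all_reals all_analysis.
From mathcomp Require Import complex.
From mathcomp Require Import measurable_realfun ring lra.

Import Order.TTheory GRing.Theory Num.Theory.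
Import numFieldNormedType.Exports HBNNSimple.
Local Open Scope classical_set_scope.
Local Open Scope ring_scope.

Set Implicit Arguments.
Unset Strict Implicit.

(** On Gbar the vectors are real unit vectors with a positive coordinate of
    index [d].  Letting [a] tend to infinity, [sigmoid (a * (t - c))] tends to a
    step function of [t = |<x|z>|^2], and step functions with thresholds in
    [0, 1] approximate every Lipschitz function of [t]; for real [z] this gives
    [cos (s * <x, z>)].  The span of the functions [cos <x, w>] is an algebra
    because of the product formula for cosines, so its closure under bounded
    pointwise limits is an algebra as well, and the sets whose indicator lies
    in this closure form a sigma-algebra.  It contains the sublevel sets of the
    functions of the closure, in particular of polynomials in the products
    [x_i x_j].  These products determine the topology of Gbar, as the sign of
    [x] is fixed by its positive coordinate, so all Borel sets are reached.
    Finally, L^2-limits of members of Q are stable under dominated convergence,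
    and simple functions are dense in L^2. *)

(** * Estimates on the line *)

Section RealAnalysis.
Variable R : realType.
Implicit Types (x y t : R) (u : R^nat).

Lemma cvg_harmonic_bound u (l C : R) :
  (forall k, `|u k - l| <= C * k.+1%:R^-1) -> u @ \oo --> l.
Proof.
move=> h; apply/cvgrPdist_le => e e0.
have : (C * harmonic k) @[k --> \oo] --> C * (0 : R).
  by apply: cvgM; [exact: cvg_cst|exact: cvg_harmonic].
rewrite mulr0 => /cvgrPdist_le/(_ e e0)[N _ hN]; exists N => // k /hN /=.
rewrite sub0r normrN distrC => hk; apply: (le_trans (h k)).
by apply: le_trans hk; exact: ler_norm.
Qed.

Lemma normr_sin_le x : `|sin x| <= `|x|.
Proof.
wlog x0 : x / 0 <= x.
  move=> h; have [/h//|x0] := leP 0 x.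
  by rewrite -normrN -sinN -(normrN x); apply: h; rewrite oppr_ge0 ltW.
have [c _] := @MVT_segment R sin cos 0 x x0 (fun y _ => is_derive_sin y)
  (continuous_subspaceT (@continuous_sin R)).
rewrite sin0 !subr0 => ->; rewrite normrM ler_piMl//; exact: cos_max.
Qed.

(** The sum-to-product formula writes the difference as a product of two sines. In other words,
    [cos (Num.sqrt t)] is Lipschitz in [t]. *)
Lemma cos_sqr_lipschitz x y : `|cos x - cos y| <= `|x ^+ 2 - y ^+ 2| / 2.
Proof.
set a := (x + y) / 2; set b := (x - y) / 2.
have -> : x = a + b by rewrite /a /b; lra.
have -> : y = a - b by rewrite /a /b; lra.
rewrite cosD cosB.
have -> : cos a * cos b - sin a * sin b - (cos a * cos b + sin a * sin b) =
  - 2 * (sin a * sin b) by ring.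
have -> : (a + b) ^+ 2 - (a - b) ^+ 2 = 4 * (a * b) by ring.
rewrite 2!normrM normrN [X in _ <= X / _]normrM.
have -> : `|4| = 4 :> R by rewrite ger0_norm.
have -> : `|2| = 2 :> R by rewrite ger0_norm.
have := ler_pM (normr_ge0 _) (normr_ge0 _) (normr_sin_le a) (normr_sin_le b).
rewrite -!normrM; lra.
Qed.

(** The mean value theorem gives [sin x - x = x * (cos c - cos 0)] with [c] between [0] and [x], and
    [cos_sqr_lipschitz] bounds the last factor. *)
Lemma sin_sub_le x : `|sin x - x| <= `|x| ^+ 3 / 2.
Proof.
wlog x0 : x / 0 <= x.
  move=> h; have [/h//|x0] := leP 0 x.
  have := h (- x); rewrite oppr_ge0 (ltW x0) => /(_ isT).
  by rewrite sinN -opprD !normrN.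
have [c c0x] := @MVT_segment R sin cos 0 x x0 (fun y _ => is_derive_sin y)
  (continuous_subspaceT (@continuous_sin R)).
rewrite sin0 !subr0 => ->.
have -> : cos c * x - x = x * (cos c - cos 0) by rewrite cos0; ring.
rewrite normrM exprS -mulrA ler_wpM2l//.
apply: (le_trans (cos_sqr_lipschitz _ _)).
rewrite ler_wpM2r ?invr_ge0// expr0n /= subr0 normrX.
move: c0x; rewrite in_itv /= => /andP[c0 cx].
by rewrite !ger0_norm// ler_pXn2r// nnegrE.
Qed.

(** The half-angle formula turns [1 - cos (e * v)] into a squared sine, close to [(e * v) ^+ 2 / 2].
    Squares are thus recovered from cosines, with an error linear in [e]. *)
Lemma sqr_from_cos_bound (v e : R) : 0 < e -> e <= 1 ->
  `|2 * e ^- 2 * (1 - cos (e * v)) - v ^+ 2| <= `|v| ^+ 4 * e.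
Proof.
move=> e0 e1; set s := sin (e * v / 2).
have en0 : e != 0 by rewrite gt_eqF.
have -> : 1 - cos (e * v) = 2 * s ^+ 2.
  have -> : e * v = (e * v / 2) *+ 2 by rewrite mulr2n; lra.
  by rewrite cos_mulr2n /s cos2sin2; ring.
pose w := e * v / 2.
have hs : `|s - w| <= `|w| ^+ 3 / 2 by exact: sin_sub_le.
have hsw : `|s| <= `|w| by exact: normr_sin_le.
have hv : v = 2 * w / e by rewrite /w; field.
have -> : `|v| = 2 * `|w| / e.
  rewrite hv normrM normfV (gtr0_norm e0) normrM.
  by have -> : `|2| = 2 :> R by rewrite ger0_norm.
rewrite {1}hv; clearbody w.
have -> : 2 * e ^- 2 * (2 * s ^+ 2) - (2 * w / e) ^+ 2 =
   4 * e ^- 2 * ((s - w) * (s + w)) by field.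
have hp : `|s + w| <= 2 * `|w|.
  by apply: (le_trans (ler_normD _ _)); lra.
have h := ler_pM (normr_ge0 _) (normr_ge0 _) hs hp.
rewrite normrM (normrM (s - w)) ger0_norm; last first.
  by rewrite mulr_ge0// invr_ge0 exprn_ge0// ltW.
apply: (@le_trans _ _ (4 * e ^- 2 * (`|w| ^+ 4))).
  rewrite ler_wpM2l//; first by rewrite mulr_ge0// invr_ge0 exprn_ge0// ltW.
  by apply: (le_trans h); rewrite le_eqVlt; apply/orP; left; apply/eqP; field.
(* The bound claimed exceeds the one obtained by the factor [4 / e], at least [1] because
   [e <= 1]. *)
have -> : (2 * `|w| / e) ^+ 4 * e = 4 * e ^- 2 * `|w| ^+ 4 * (4 / e) by field.
rewrite ler_peMr//.
  by rewrite mulr_ge0// ?mulr_ge0// ?invr_ge0 exprn_ge0// ltW.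
rewrite ler_pdivlMr// mul1r; lra.
Qed.

(** * Limits of sigmoids and staircase approximation *)

Lemma sigmoid_ge0 t : 0 <= sigmoid t.
Proof. by rewrite /sigmoid divr_ge0// addr_ge0// expR_ge0. Qed.

Lemma sigmoid_le1 t : sigmoid t <= 1.
Proof.
by rewrite /sigmoid ler_pdivrMr ?mul1r ?lerDl ?expR_ge0// addr_gt0// expR_gt0.
Qed.

Lemma sigmoid0 : sigmoid 0 = 2^-1 :> R.
Proof. by rewrite /sigmoid oppr0 expR0 mul1r. Qed.

Lemma sigmoidN t : sigmoid (- t) = 1 - sigmoid t.
Proof.
rewrite /sigmoid opprK.
have h : expR (- t) * expR t = 1 by rewrite mulrC expRxMexpNx_1.
have p1 := expR_gt0 t; have p2 := expR_gt0 (- t).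
have q1 : 1 + expR t != 0 by rewrite gt_eqF// addr_gt0.
have q2 : 1 + expR (- t) != 0 by rewrite gt_eqF// addr_gt0.
apply: (mulfI q1); rewrite mulrCA mulfV// mulr1 mulrBr mulr1 mulrA mulr1.
apply: (mulIf q2); rewrite mulrBl divfK//; lra.
Qed.

Lemma sigmoid_sub1_le t : 0 <= t -> `|sigmoid t - 1| <= (1 + t)^-1.
Proof.
move=> t0; rewrite distrC ger0_norm ?subr_ge0 ?sigmoid_le1// -sigmoidN.
have h := expR_ge1Dx t.
by rewrite /sigmoid opprK mul1r lef_pV2 ?posrE; lra.
Qed.

(** The Heaviside function with value [1/2] at [0], the value imposed by [sigmoid 0]. *)
Definition step t : R := (Num.sg t + 1) / 2.

Lemma cvg_sigmoid_step t : sigmoid (k.+1%:R * t) @[k --> \oo] --> step t.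
Proof.
wlog t0 : t / 0 <= t.
  move=> h; have [/h//|t0] := leP 0 t.
  have -> : step t = 1 - step (- t) by rewrite /step sgrN; lra.
  under eq_fun => k do rewrite -(opprK (k.+1%:R * t)) -mulrN sigmoidN.
  by apply: cvgB; [exact: cvg_cst|apply: h; rewrite oppr_ge0 ltW].
move: t0; rewrite le_eqVlt => /orP[/eqP<-|t0].
  rewrite /step sgr0 add0r mul1r; under eq_fun do rewrite mulr0 sigmoid0.
  exact: cvg_cst.
rewrite /step gtr0_sg// divff//.
apply: (@cvg_harmonic_bound _ _ t^-1) => k.
have kt : 0 < k.+1%:R * t by rewrite mulr_gt0.
apply: (le_trans (sigmoid_sub1_le (ltW kt))).
rewrite -invfM mulrC lef_pV2 ?posrE//; lra.
Qed.

(** Slopes tending to [0] flatten the sigmoid to a constant; this is how constants are reached from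
    sums without a constant term. *)
Lemma cvg_sigmoid_half t : sigmoid (k.+1%:R^-1 * t) @[k --> \oo] --> (2^-1 : R).
Proof.
have c : {for (0:R), continuous (@sigmoid R)}.
  rewrite /sigmoid; apply: cvgM; first exact: cvg_cst.
  apply: cvgV; first by rewrite oppr0 expR0 gt_eqF.
  apply: cvgD; first exact: cvg_cst.
  apply: continuous_comp; [exact: opp_continuous|exact: continuous_expR].
rewrite -sigmoid0.
have h : (k.+1%:R^-1 * t) @[k --> \oo] --> (0 : R).
  rewrite -[X in _ --> X](mul0r t).
  by apply: cvgM; [exact: cvg_harmonic|exact: cvg_cst].
exact: (cvg_comp _ _ h c).
Qed.

(** A telescoping sum over a grid of mesh [m.+1%:R^-1]: the steps below [t] add up to the value of
    [phi] at a grid point next to [t], and those above contribute nothing. *)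
Lemma step_approx (phi : R -> R) (L t : R) (m : nat) :
  (forall a b, 0 <= a <= 1 -> 0 <= b <= 1 -> `|phi a - phi b| <= L * `|a - b|) ->
  0 <= t <= 1 ->
  `|phi 0 + \sum_(i < m.+1) (phi (i.+1%:R / m.+1%:R) - phi (i%:R / m.+1%:R)) *
     step (t - i.+1%:R / m.+1%:R) - phi t| <= L * m.+1%:R^-1.
Proof.
move=> lip t01; have m0 : 0 < m.+1%:R :> R by [].
have L0 : 0 <= L.
  have := lip 1 0; rewrite !lexx !ler01 => /(_ isT isT).
  by rewrite subr0 normr1 mulr1; apply: le_trans.
pose S j := phi 0 + \sum_(i < j) (phi (i.+1%:R / m.+1%:R) - phi (i%:R / m.+1%:R)) *
     step (t - i.+1%:R / m.+1%:R).
(* The partial sum is exact at grid point [j] while [t] lies beyond it. Once [t] is passed, the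
   approximation of [phi t] is reached and kept. *)
suff H j : (j <= m.+1)%N ->
   (j%:R / m.+1%:R < t -> S j = phi (j%:R / m.+1%:R)) /\
   (t <= j%:R / m.+1%:R -> `|S j - phi t| <= L * m.+1%:R^-1).
  have [_] := H m.+1 (leqnn _); apply; rewrite divff ?gt_eqF//.
  by case/andP: t01.
elim: j => [|j IH] jm.
  rewrite mul0r /S big_ord0 addr0; split => // t0.
  have -> : t = 0 by lra.
  by rewrite subrr normr0 mulr_ge0// invr_ge0.
have [IH1 IH2] := IH (ltnW jm).
have SS : S j.+1 = S j + (phi (j.+1%:R / m.+1%:R) - phi (j%:R / m.+1%:R)) *
     step (t - j.+1%:R / m.+1%:R) by rewrite /S big_ord_recr /= addrA.
have jj : j.+1%:R / m.+1%:R = j%:R / m.+1%:R + m.+1%:R^-1 :> R.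
  by rewrite -natr1 mulrDl mul1r.
have j0 : 0 <= j%:R / m.+1%:R :> R by rewrite divr_ge0.
have j1 : j.+1%:R / m.+1%:R <= 1 :> R by rewrite ler_pdivrMr// mul1r ler_nat.
have i0 : 0 < m.+1%:R^-1 :> R by rewrite invr_gt0.
rewrite SS; move: j0 j1 i0 IH1 IH2; rewrite jj.
set c := j%:R / _; set h := m.+1%:R^-1 => c0 ch1 h0 IH1 IH2; split=> ht.
  rewrite IH1; last lra.
  by rewrite /step gtr0_sg ?subr_gt0// divff// mulr1 addrC subrK.
have [tc|ct] := leP t c.
  rewrite /step ltr0_sg; last lra.
  by rewrite addNr mul0r mulr0 addr0; exact: IH2.
have s01 : 0 <= step (t - (c + h)) <= 1.
  rewrite /step; have [e|ne] := eqVneq t (c + h).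
    by rewrite e subrr sgr0; lra.
  rewrite ltr0_sg ?addNr ?mul0r ?lexx ?ler01//.
  by rewrite subr_lt0 lt_neqAle ne.
(* Here [c < t <= c + h]. The step is [0], or [1/2] if [t = c + h]; in both cases the sum is a
   convex combination of [phi c] and [phi (c + h)], each within [L * h] of [phi t]. *)
rewrite IH1//; move: (step _) s01 => s s01.
have -> : phi c + (phi (c + h) - phi c) * s - phi t =
  (1 - s) * (phi c - phi t) + s * (phi (c + h) - phi t) by ring.
have b1 : `|phi c - phi t| <= L * h.
  apply: (le_trans (lip _ _ _ _)) => //; first lra.
  by rewrite ler_wpM2l// ler_norml; lra.
have b2 : `|phi (c + h) - phi t| <= L * h.
  apply: (le_trans (lip _ _ _ _)) => //; first lra.
  by rewrite ler_wpM2l// ler_norml; lra.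
case/andP: s01 => s0 s1.
apply: (le_trans (ler_normD _ _)); rewrite !normrM.
rewrite (ger0_norm s0) (ger0_norm (x := 1 - s)); last lra.
have -> : L * h = (1 - s) * (L * h) + s * (L * h) by ring.
by apply: lerD; apply: ler_wpM2l => //; lra.
Qed.

(** * Bernoulli inequalities and polynomial thresholds *)

(** A Bernoulli bound makes [r ^+ k] of order [1/k]; squaring it, with [x = r ^+ 2], makes [x ^+ k]
    of order [1/k^2], which absorbs the factor [k]. *)
Lemma expr_harmonic_bound x : 0 <= x -> x < 1 ->
  exists C, forall k, k%:R * x ^+ k <= C * k.+1%:R^-1.
Proof.
move=> x0 x1; pose r := Num.sqrt x.
have r0 : 0 <= r by exact: sqrtr_ge0.
have rr : x = r ^+ 2 by rewrite sqr_sqrtr.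
have r1 : r < 1 by rewrite -[1]sqrtr1 ltr_sqrt.
have B k : r ^+ k * (1 + k%:R * (1 - r)) <= 1.
  elim: k => [|k IH]; first by rewrite mul0r addr0 mulr1.
  apply: le_trans IH; rewrite exprSr -mulrA ler_wpM2l ?exprn_ge0//.
  rewrite -natr1.
  have : 0 <= k.+1%:R * (1 - r) ^+ 2 by rewrite mulr_ge0// sqr_ge0.
  rewrite -natr1; nra.
exists ((1 - r) ^- 2) => k.
rewrite ler_pdivlMr// -[leRHS]mulr1 ler_pdivlMl ?exprn_gt0 ?subr_gt0//.
have Bk := B k.
have h : r ^+ k * (k.+1%:R * (1 - r)) <= 1.
  apply: le_trans Bk; rewrite ler_wpM2l ?exprn_ge0//.
  rewrite -natr1; lra.
have h0 : 0 <= r ^+ k * (k.+1%:R * (1 - r)).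
  by rewrite !mulr_ge0 ?exprn_ge0// subr_ge0 ltW.
have h2 : (r ^+ k * (k.+1%:R * (1 - r))) ^+ 2 <= 1 by rewrite expr_le1.
apply: le_trans h2; rewrite rr -exprM mulnC exprM.
have -> : (r ^+ k * (k.+1%:R * (1 - r))) ^+ 2 =
  (1 - r) ^+ 2 * (k.+1%:R * (r ^+ k) ^+ 2 * k.+1%:R) by ring.
rewrite ler_wpM2l ?sqr_ge0// ler_wpM2r// ler_wpM2r ?sqr_ge0//.
by rewrite ler_nat.
Qed.

Lemma bernoulli_ge (y : R) m : 0 <= y <= 1 -> 1 - m%:R * y <= (1 - y) ^+ m.
Proof.
move=> /andP[y0 y1]; elim: m => [|m IH]; first by rewrite mul0r subr0.
rewrite exprSr; apply: (@le_trans _ _ ((1 - m%:R * y) * (1 - y))).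
  rewrite -natr1; have : 0 <= m%:R * y ^+ 2 by rewrite mulr_ge0// sqr_ge0.
  nra.
by rewrite ler_wpM2r// subr_ge0.
Qed.

Lemma bernoulli_le (y : R) m : 0 <= y <= 1 -> (1 - y) ^+ m <= (1 + m%:R * y)^-1.
Proof.
move=> /andP[y0 y1]; have my j : 0 < 1 + j%:R * y by rewrite ltr_wpDr// mulr_ge0.
rewrite -[leRHS]mul1r ler_pdivlMr//.
elim: m => [|m IH]; first by rewrite mul0r addr0 mulr1.
apply: le_trans IH; rewrite exprSr -mulrA ler_wpM2l ?exprn_ge0 ?subr_ge0//.
rewrite -natr1; have : 0 <= m%:R * y ^+ 2 by rewrite mulr_ge0// sqr_ge0.
nra.
Qed.

(* The power [k * 2 ^ k], rather than [2 ^ k], forces the limit [0] at [1/2]. *)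
Lemma cvg_threshold t : 0 <= t <= 1 ->
  (1 - t ^+ k) ^+ (k * 2 ^ k)%N @[k --> \oo] --> ((t < 2^-1)%R%:R : R).
Proof.
move=> /andP[t0 t1].
have tk k : 0 <= t ^+ k <= 1 by rewrite exprn_ge0// exprn_ile1.
(* Both Bernoulli bounds depend on this product only: it tends to [0] if [t < 1/2] and is at least
   [k] otherwise. *)
have E k : (k * 2 ^ k)%N%:R * t ^+ k = k%:R * (2 * t) ^+ k :> R.
  by rewrite natrM natrX exprMn mulrA.
have [th|th] := ltP t 2^-1.
  have [||C hC] := expr_harmonic_bound (x := 2 * t); [lra|lra|].
  apply: (@cvg_harmonic_bound _ _ C) => k; apply: le_trans (hC k).
  have := bernoulli_ge (k * 2 ^ k)%N (tk k); rewrite E => h.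
  rewrite distrC ger0_norm; first by rewrite lerBlDl -lerBlDr.
  by case/andP: (tk k) => *; rewrite subr_ge0 exprn_ile1//; lra.
apply: (@cvg_harmonic_bound _ _ 1) => k.
rewrite subr0 ger0_norm; last by rewrite exprn_ge0// subr_ge0; case/andP: (tk k).
apply: (le_trans (bernoulli_le (k * 2 ^ k)%N (tk k))).
rewrite E mul1r lef_pV2 ?posrE//; last first.
  by rewrite ltr_wpDr// mulr_ge0// exprn_ge0//; lra.
rewrite -natr1 addrC lerD2l ler_peMr// exprn_ege1//; lra.
Qed.

End RealAnalysis.

(** * Bounded pointwise closure *)

Section BoundedPointwiseClosure.
Variables (R : realType) (T : Type) (D : set T).
Implicit Types (S : set (T -> R)) (f g : T -> R).

(** The least vector space containing [S] and stable under pointwise limits on [D] of sequences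
    uniformly bounded on [D]. The inductive form allows limits to be iterated without indexing them
    by ordinals. *)
Inductive bpclosure S : (T -> R) -> Prop :=
| bpc_base f of S f : bpclosure S f
| bpc_lin0 : bpclosure S (fun=> 0)
| bpc_lin a f g of bpclosure S f & bpclosure S g :
    bpclosure S (fun x => a * f x + g x)
| bpc_lim (u : nat -> T -> R) g M of (forall k, bpclosure S (u k)) &
    (forall k x, D x -> `|u k x| <= M) &
    (forall x, D x -> u k x @[k --> \oo] --> g x) : bpclosure S g.

Section Linear.
Variable S : set (T -> R).

(** A constant sequence has every function equal to it on [D] as a limit, so values outside [D] can
    be changed freely. *)
Lemma bpc_eq f g : bpclosure S f -> (forall x, D x -> f x = g x) ->
  (exists M, forall x, D x -> `|f x| <= M) -> bpclosure S g.
Proof.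
move=> Sf fg [M fM]; apply: (@bpc_lim _ (fun=> f) _ M) => // x Dx.
by rewrite fg//; exact: cvg_cst.
Qed.

Lemma bpc_bounded f : (forall g, S g -> exists M, forall x, D x -> `|g x| <= M) ->
  bpclosure S f -> exists M, forall x, D x -> `|f x| <= M.
Proof.
move=> bS; elim => [{}f /bS//||a {}f g _ [M fM] _ [N gN]|u g M _ _ uM ug].
- by exists 0 => x _; rewrite normr0.
- exists (`|a| * M + N) => x Dx; apply: (le_trans (ler_normD _ _)).
  by rewrite lerD ?gN// normrM ler_wpM2l// fM.
- exists M => x Dx.
  by apply: (cvgr_to_le (cvg_norm (ug x Dx))); apply: nearW => k; exact: uM.
Qed.

Lemma bpc_scale a f : bpclosure S f -> bpclosure S (fun x => a * f x).
Proof.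
move=> Sf; have := bpc_lin a Sf (bpc_lin0 S).
by under eq_fun do rewrite addr0.
Qed.

Lemma bpc_add f g : bpclosure S f -> bpclosure S g ->
  bpclosure S (fun x => f x + g x).
Proof.
by move=> Sf Sg; have := bpc_lin 1 Sf Sg; under eq_fun do rewrite mul1r.
Qed.

Lemma bpc_sub f g : bpclosure S f -> bpclosure S g ->
  bpclosure S (fun x => f x - g x).
Proof.
move=> Sf Sg; have := bpc_lin (-1) Sg Sf.
by under eq_fun do rewrite mulN1r addrC.
Qed.

Lemma bpc_sum (I : Type) (r : seq I) (F : I -> T -> R) :
  (forall i, bpclosure S (F i)) -> bpclosure S (fun x => \sum_(i <- r) F i x).
Proof.
move=> SF; elim: r => [|i r IH].
  by under eq_fun do rewrite big_nil; exact: bpc_lin0.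
by under eq_fun do rewrite big_cons; exact: bpc_add.
Qed.

End Linear.

Lemma bpc_sub_closure S S' f : (forall g, S g -> bpclosure S' g) ->
  bpclosure S f -> bpclosure S' f.
Proof.
move=> SS'; elim => [g /SS'//||a g h _ Sg _ Sh|u g M _ IH uM ug].
- exact: bpc_lin0.
- exact: bpc_lin.
- exact: bpc_lim uM ug.
Qed.

Section Algebra.
Variable S : set (T -> R).
Hypothesis S_bounded : forall g, S g -> exists M, forall x, D x -> `|g x| <= M.
Hypothesis S_cst1 : bpclosure S (fun=> 1).
Hypothesis S_mul : forall f g, S f -> S g -> bpclosure S (fun x => f x * g x).

Lemma bpc_mul_lim f (u : nat -> T -> R) g M : bpclosure S f ->
  (forall k, bpclosure S (fun x => f x * u k x)) ->
  (forall k x, D x -> `|u k x| <= M) ->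
  (forall x, D x -> u k x @[k --> \oo] --> g x) ->
  bpclosure S (fun x => f x * g x).
Proof.
move=> Sf Sfu uM ug; have [N fN] := bpc_bounded S_bounded Sf.
apply: (@bpc_lim _ (fun k x => f x * u k x) _ (N * M)) => //.
- by move=> k x Dx; rewrite normrM ler_pM ?fN ?uM.
- by move=> x Dx; apply: cvgM; [exact: cvg_cst|exact: ug].
Qed.

(** Two nested inductions: products with a fixed element of [S] are handled first, and then serve as
    the base case for an arbitrary left factor. *)
Lemma bpc_mul f g : bpclosure S f -> bpclosure S g ->
  bpclosure S (fun x => f x * g x).
Proof.
move=> Sf; elim: Sf g => [{}f Sf||a {}f h _ Sf _ Sh|u {}f M Su IH uM uf] g Sg.
- elim: Sg => [{}g Sg||a {}g h _ Sfg _ Sfh|u {}g M Su IH uM ug].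
  + exact: S_mul.
  + by under eq_fun do rewrite mulr0; exact: bpc_lin0.
  + under eq_fun do rewrite mulrDr mulrCA; exact: bpc_lin.
  + by apply: bpc_mul_lim uM ug => //; exact: bpc_base.
- by under eq_fun do rewrite mul0r; exact: bpc_lin0.
- under eq_fun do rewrite mulrDl -mulrA; exact: bpc_lin (Sf _ Sg) (Sh _ Sg).
- under eq_fun do rewrite mulrC; apply: bpc_mul_lim uM uf => // k.
  by under eq_fun do rewrite mulrC; exact: IH.
Qed.

Lemma bpc_cst a : bpclosure S (fun=> a).
Proof.
by have := bpc_scale a S_cst1; under eq_fun do rewrite mulr1.
Qed.

Lemma bpc_exp f n : bpclosure S f -> bpclosure S (fun x => f x ^+ n).
Proof.
move=> Sf; elim: n => [|n IH]; first by under eq_fun do rewrite expr0.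
by under eq_fun do rewrite exprS; exact: bpc_mul.
Qed.

(** An affine change of scale sends [f] into [[0, 1]] and the level [c] to [1/2]. The polynomials of
    [cvg_threshold] then converge to the indicator. *)
Lemma bpc_lt_indic f c : bpclosure S f -> bpclosure S (\1_[set x | f x < c]).
Proof.
move=> Sf; have [M fM] := bpc_bounded S_bounded Sf.
(* [K] bounds [f - c] on [D], and is positive whatever the sign of [M]. *)
pose K := `|M| + `|c| + 1.
have K0 : 0 < K by rewrite ltr_wpDl// addr_ge0.
pose g x := (f x - c) * (2 * K)^-1 + 2^-1.
have Sg : bpclosure S g.
  apply: bpc_add; last exact: bpc_cst.
  under eq_fun do rewrite mulrC; apply: bpc_scale.
  by apply: bpc_sub => //; exact: bpc_cst.
have g01 x : D x -> 0 <= g x <= 1.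
  move=> Dx; have : `|f x - c| <= K.
    apply: (le_trans (ler_normB _ _)); have := fM x Dx; have := ler_norm M.
    rewrite /K; lra.
  rewrite ler_norml /g => /andP[l1 l2].
  have e : K * (2 * K)^-1 = 2^-1 by field; rewrite gt_eqF.
  have i0 : 0 <= (2 * K)^-1 by rewrite invr_ge0 mulr_ge0// ltW.
  have := ler_wpM2r i0 l1; have := ler_wpM2r i0 l2; rewrite mulNr e; lra.
apply: (@bpc_lim _ (fun k x => (1 - g x ^+ k) ^+ (k * 2 ^ k)%N) _ 1).
- by move=> k; apply: bpc_exp; apply: bpc_sub; [exact: S_cst1|exact: bpc_exp].
- move=> k x /g01/andP[g0 g1].
  have a0 : 0 <= g x ^+ k by rewrite exprn_ge0.
  have a1 : g x ^+ k <= 1 by rewrite exprn_ile1.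
  by rewrite ger0_norm ?exprn_ge0 ?exprn_ile1//; lra.
- move=> x /g01 gx.
  have -> : \1_[set x | f x < c] x = (g x < 2^-1)%R%:R :> R.
    rewrite indicE /g gtrDr pmulr_llt0 ?invr_gt0 ?mulr_gt0// subr_lt0.
    by congr (nat_of_bool _)%:R; apply/idP/idP; rewrite inE.
  exact: cvg_threshold.
Qed.

Definition bpc_sets : set (set T) := [set A | bpclosure S (\1_A)].

(** Intersections come from products, complements from subtraction from [1], and countable unions
    from the bounded limit of the finite unions. *)
Lemma bpc_sets_sigma_algebra : sigma_algebra [set: T] bpc_sets.
Proof.
have capP A B : bpc_sets A -> bpc_sets B -> bpc_sets (A `&` B).
  by move=> SA SB; rewrite /bpc_sets /= indicI; exact: bpc_mul.
have CP A : bpc_sets A -> bpc_sets (~` A).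
  move=> SA; rewrite /bpc_sets /= indicC.
  have := bpc_sub S_cst1 SA; congr (bpclosure _ _); apply/funext => x.
  by rewrite indicE; case: (x \in A); rewrite ?subrr ?subr0.
have cupP A B : bpc_sets A -> bpc_sets B -> bpc_sets (A `|` B).
  by move=> SA SB; rewrite -(setCK (A `|` B)) setCU; apply/CP/capP; exact: CP.
split.
- by rewrite /bpc_sets /= indic0; exact: bpc_lin0.
- by move=> A SA; rewrite setTD; exact: CP.
- move=> F SF.
  have SG n : bpc_sets (\big[setU/set0]_(i < n) F i).
    elim: n => [|n IH]; last by rewrite big_ord_recr; exact: cupP.
    by rewrite big_ord0 /bpc_sets /= indic0; exact: bpc_lin0.
  apply: (@bpc_lim _ (fun n => \1_(\big[setU/set0]_(i < n) F i)) _ 1) => //.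
    by move=> n x _; rewrite indicE; case: (_ \in _); rewrite ?normr1 ?normr0.
  move=> x Dx; rewrite !indicE.
  have [|xF] := boolP (x \in \bigcup_k F k); last first.
    apply: (@cvg_near_cst); near=> n; rewrite indicE.
    congr (_ %:R); apply/eqP; rewrite eqb0; apply: contra xF; rewrite !inE.
    by rewrite -bigcup_mkord => -[k _ Fk]; exists k.
  rewrite inE => -[m _ Fm].
  apply: (@cvg_near_cst); exists m.+1 => // n /= mn; rewrite indicE.
  by rewrite mem_set// -bigcup_mkord; exists m.
Unshelve. all: by end_near. Qed.

End Algebra.
End BoundedPointwiseClosure.

(** * Approximation in L^2 *)

Section L2Closure.
Context d (T : measurableType d) (R : realType).
Variables (mu : {finite_measure set T -> \bar R}) (D : set T).
Hypothesis mD : measurable D.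
Variable S : set (T -> R).
Hypothesis S_meas : forall q, S q -> measurable_fun D q.
Hypothesis S0 : S (fun=> 0).
Hypothesis S_lin : forall a f g, S f -> S g -> S (fun x => a * f x + g x).
Implicit Types f g h : T -> R.

Local Notation sqint f := (\int[mu]_(x in D) (f x ^+ 2)%:E)%E.

Definition L2closure f := measurable_fun D f /\
  forall e : R, 0 < e -> exists2 q, S q & (sqint (fun x => q x - f x)%R < e%:E)%E.

Lemma measurable_EFin_sqr f : measurable_fun D f ->
  measurable_fun D (EFin \o (fun x => f x ^+ 2)).
Proof. by move=> mf; apply/measurable_EFinP; exact: measurable_funX. Qed.

(** This stands in for the Minkowski inequality: a pointwise quadratic bound is integrated directly,
    without square roots or prior integrability. *)
Lemma sqint_le f g h (a b e1 e2 : R) : 0 <= a -> 0 <= b ->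
  measurable_fun D f -> measurable_fun D g -> measurable_fun D h ->
  (forall x, D x -> h x ^+ 2 <= a * f x ^+ 2 + b * g x ^+ 2) ->
  (sqint f <= e1%:E)%E -> (sqint g <= e2%:E)%E ->
  (sqint h <= (a * e1 + b * e2)%:E)%E.
Proof.
move=> a0 b0 mf mg mh hle fe ge.
have m1 : measurable_fun D (EFin \o (fun x => a * f x ^+ 2)).
  by apply/measurable_EFinP; apply: measurable_funM => //; exact: measurable_funX.
have m2 : measurable_fun D (EFin \o (fun x => b * g x ^+ 2)).
  by apply/measurable_EFinP; apply: measurable_funM => //; exact: measurable_funX.
apply: (@le_trans _ _ (\int[mu]_(x in D) ((a * f x ^+ 2)%:E + (b * g x ^+ 2)%:E))%E).
  apply: ge0_le_integral => //.
  - by move=> x _; rewrite lee_fin sqr_ge0.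
  - exact: measurable_EFin_sqr.
  - by apply: emeasurable_funD.
rewrite ge0_integralD//; last 2 first.
- by move=> x _; rewrite lee_fin mulr_ge0// sqr_ge0.
- by move=> x _; rewrite lee_fin mulr_ge0// sqr_ge0.
under eq_integral do rewrite EFinM.
under [X in (_ + X)%E]eq_integral do rewrite EFinM.
rewrite !ge0_integralZl//; try exact: measurable_EFin_sqr;
  try by move=> x _; rewrite lee_fin sqr_ge0.
by rewrite EFinD !EFinM leeD// lee_wpmul2l// lee_fin.
Qed.

Lemma L2closure_base q : S q -> L2closure q.
Proof.
move=> Sq; split=> [|e e0]; first exact: S_meas.
exists q => //; under eq_integral do rewrite subrr expr0n /=.
by rewrite integral0 lte_fin.
Qed.

Lemma L2closure_lin0 : L2closure (fun=> 0).
Proof. exact: L2closure_base. Qed.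

Lemma L2closure_lin a f g : L2closure f -> L2closure g ->
  L2closure (fun x => a * f x + g x).
Proof.
move=> [mf Hf] [mg Hg].
have mw p q : measurable_fun D p -> measurable_fun D q ->
    measurable_fun D (fun x => a * p x + q x).
  by move=> mp mq; apply: measurable_funD => //; exact: measurable_funM.
split; first exact: mw.
(* Adding [1] to [a ^+ 2] keeps the divisor positive when [a = 0]. Each of the two terms of the
   final bound is at most [e / 4]. *)
move=> e e0; have A0 : 0 < 8 * (a ^+ 2 + 1) by rewrite mulr_gt0// ltr_wpDl// sqr_ge0.
have [p Sp pf] := Hf (e / (8 * (a ^+ 2 + 1))) (divr_gt0 e0 A0).
have [q Sq qg] := Hg (e / 8) (divr_gt0 e0 (ltr0Sn _ _)).
exists (fun x => a * p x + q x); first exact: S_lin.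
have mp := S_meas Sp; have mq := S_meas Sq.
apply: (@le_lt_trans _ _ ((2 * a ^+ 2) * (e / (8 * (a ^+ 2 + 1))) + 2 * (e / 8))%:E).
  apply: (@sqint_le (fun x => p x - f x) (fun x => q x - g x)).
  - by rewrite mulr_ge0// sqr_ge0.
  - by [].
  - exact: measurable_funB.
  - exact: measurable_funB.
  - by apply: measurable_funB; exact: mw.
  - move=> x _.
    have := sqr_ge0 (a * (p x - f x) - (q x - g x)); nra.
  - exact: ltW.
  - exact: ltW.
rewrite lte_fin.
have -> : 2 * a ^+ 2 * (e / (8 * (a ^+ 2 + 1))) = e / 4 * (a ^+ 2 / (a ^+ 2 + 1)).
  by field; rewrite gt_eqF// ltr_wpDl// sqr_ge0.
have : a ^+ 2 / (a ^+ 2 + 1) <= 1.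
  by rewrite ler_pdivrMr ?mul1r ?lerDl// ltr_wpDl// sqr_ge0.
have e4 : 0 <= e / 4 by rewrite divr_ge0// ltW.
move=> h1; have := ler_wpM2l e4 h1; lra.
Qed.

(** The squared differences are dominated by [4 * h ^+ 2], so their integrals tend to [0]; an
    approximant of a late [u k] then approximates [g]. *)
Lemma L2closure_dominated (u : nat -> T -> R) g h :
  (forall k, L2closure (u k)) ->
  (forall k x, D x -> `|u k x| <= h x) ->
  (forall x, D x -> u k x @[k --> \oo] --> g x) ->
  mu.-integrable D (fun x => (h x ^+ 2)%:E) -> L2closure g.
Proof.
move=> Hu uh ug ih.
have mu_ k : measurable_fun D (u k) by case: (Hu k).
have mg : measurable_fun D g by exact: measurable_fun_cvg ug.
split=> // e e0.
have gh x : D x -> `|g x| <= h x.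
  move=> Dx; apply: (cvgr_to_le (cvg_norm (ug x Dx))).
  by apply: nearW => k; exact: uh.
have := @dominated_cvg _ T R mu D mD (fun k x => ((u k x - g x) ^+ 2)%:E)
  (fun=> 0%E) (fun x => (4%:E * (h x ^+ 2)%:E)%E).
rewrite integral0 => H.
have {}H : (sqint (fun x => u k x - g x)%R) @[k --> \oo] --> 0%E.
  apply: H.
  - by move=> k; apply: measurable_EFin_sqr; exact: measurable_funB.
  - move=> x Dx; apply: cvg_EFin; first by apply: nearW.
    have : (u k x - g x) ^+ 2 @[k --> \oo] --> (g x - g x) ^+ 2.
      by apply: cvgM; apply: cvgB; (exact: ug || exact: cvg_cst).
    by rewrite subrr expr0n.
  - by [].
  - exact: integrableZl.
  - move=> k x Dx; rewrite gee0_abs ?lee_fin ?sqr_ge0//.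
    have : `|u k x - g x| <= 2 * h x.
      by apply: (le_trans (ler_normB _ _)); have := uh k x Dx; have := gh x Dx; lra.
    have -> : 4 * h x ^+ 2 = (2 * h x) ^+ 2 by ring.
    move=> l; rewrite -[leLHS]real_normK ?num_real// ler_pXn2r// nnegrE.
    exact: le_trans l.
have [k uk] : exists k, (sqint (fun x => u k x - g x)%R < (e / 4)%:E)%E.
  have e4 : 0 < e / 4 by rewrite divr_gt0.
  move/fine_cvgP : H => [Hfin /cvgrPdist_lt /(_ _ e4) Hlt].
  have [k [f1 f2]] : exists k, sqint (fun x => u k x - g x)%R \is a fin_num /\
      `|0 - fine (sqint (fun x => u k x - g x)%R)| < e / 4.
    near \oo => k; exists k; split; near: k; [exact: Hfin|exact: Hlt].
  exists k; rewrite -(fineK f1) lte_fin; apply: le_lt_trans f2.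
  by rewrite sub0r normrN ler_norm.
(* Errors [e / 5] and [e / 4], each doubled by the quadratic triangle inequality, sum to
   [9 * e / 10]. *)
have [_ /(_ (e / 5)) []] := Hu k; first by rewrite divr_gt0.
move=> q Sq qu; exists q => //.
apply: (@le_lt_trans _ _ (2 * (e / 5) + 2 * (e / 4))%:E); last by rewrite lte_fin; lra.
have mq := S_meas Sq.
apply: (@sqint_le (fun x => q x - u k x) (fun x => u k x - g x)) => //.
- exact: measurable_funB.
- exact: measurable_funB.
- exact: measurable_funB.
- move=> x _; have := sqr_ge0 ((q x - u k x) - (u k x - g x)); nra.
- exact: ltW.
- exact: ltW.
Unshelve. all: by end_near. Qed.

(** As [mu] is finite, the uniform bound is a square-integrable dominating function. *)
Lemma bpc_L2closure f : bpclosure D S f -> L2closure f.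
Proof.
elim => [g /L2closure_base//||a g h _ Hg _ Hh|u g M _ IH uM ug].
- exact: L2closure_lin0.
- exact: L2closure_lin.
- apply: (@L2closure_dominated u g (fun=> M)) => //.
  exact: finite_measure_integrable_cst.
Qed.

Hypothesis S_indic : forall A, measurable A -> bpclosure D S (\1_A).

(** Nonnegative simple functions increase to [f] on [D], and [f] itself dominates them. *)
Lemma L2closure_ge0 f : measurable_fun D f -> (forall x, 0 <= f x) ->
  mu.-integrable D (fun x => (f x ^+ 2)%:E) -> L2closure f.
Proof.
move=> mf f0 if2.
have mEf : measurable_fun D (EFin \o f) by exact/measurable_EFinP.
have [|s [s_nd s_f]] := @approximation _ T R D mD _ mEf.
  by move=> x _; rewrite lee_fin.
have sf x : D x -> s k x @[k --> \oo] --> f x.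
  by move=> Dx; have /fine_cvgP[] := s_f x Dx.
apply: (@L2closure_dominated (fun k => s k) f f) => //.
- move=> k; apply: bpc_L2closure.
  (* A simple function is a finite linear combination of indicators of its fibres. *)
  have -> : (s k : T -> R) =
      (fun x => \sum_(y <- finmap.enum_fset (fset_set (range (s k))))
         y * \1_(s k @^-1` [set y]) x).
    by apply/funext => x; rewrite {1}(fimfunE (s k)) fsbig_finite.
  by apply: bpc_sum => y; apply: bpc_scale; apply: S_indic.
- move=> k x Dx; rewrite ger0_norm//.
  have snd : nondecreasing_seq (fun k => s k x).
    by move=> m n mn; have /lefP := s_nd _ _ mn; exact.
  rewrite -(cvg_lim _ (sf x Dx))//; apply: nondecreasing_cvgn_le => //.
  by apply/cvg_ex; exists (f x); exact: sf.
Qed.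

Lemma L2closure_all f : measurable_fun D f ->
  mu.-integrable D (fun x => (f x ^+ 2)%:E) -> L2closure f.
Proof.
move=> mf if2.
have ge0_part (g : T -> R) : measurable_fun D g -> (forall x, 0 <= g x) ->
    (forall x, g x <= `|f x|) -> L2closure g.
  move=> mg g0 gf; apply: L2closure_ge0 => //.
  apply: (le_integrable mD _ _ if2); first exact: measurable_EFin_sqr.
  move=> x _; rewrite !gee0_abs ?lee_fin ?sqr_ge0//.
  by rewrite -[leRHS]real_normK ?num_real// ler_pXn2r ?nnegrE.
have -> : f = fun x => (-1) * f^\- x + f^\+ x.
  by apply/funext => x; rewrite mulN1r addrC -[in LHS](funrposBneg f).
apply: L2closure_lin; apply: ge0_part.
- exact: measurable_funrneg.
- by move=> x; exact: funrneg_ge0.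
- by move=> x; rewrite /funrneg ge_max -normrN ler_norm normr_ge0.
- exact: measurable_funrpos.
- by move=> x; exact: funrpos_ge0.
- by move=> x; rewrite /funrpos ge_max ler_norm normr_ge0.
Qed.

End L2Closure.

(** * Real unit vectors with a positive coordinate *)

Section Coordinates.
Variables (R : realType) (N : nat).
Implicit Types (x y z : cvec R N) (v w : 'I_N -> R).

Definition recoord x k : R := complex.Re (x 0 k).
Definition redot w x : R := \sum_k w k * recoord x k.

Lemma sum_delta (F : 'I_N -> R) i : \sum_k (k == i)%:R * F k = F i.
Proof.
rewrite (bigD1 i)//= eqxx mul1r big1 ?addr0// => k /negbTE->; exact: mul0r.
Qed.

Lemma redotD v w x : redot (fun k => v k + w k) x = redot v x + redot w x.
Proof. by rewrite /redot -big_split; apply: eq_bigr => k _; rewrite mulrDl. Qed.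

Lemma redotZ a w x : redot (fun k => a * w k) x = a * redot w x.
Proof. by rewrite /redot mulr_sumr; apply: eq_bigr => k _; rewrite mulrA. Qed.

Lemma redot_delta i x : redot (fun k => (k == i)%:R) x = recoord x i.
Proof. exact: sum_delta. Qed.

Lemma sqmod_ge0 (c : R[i]) : 0 <= sqmod c.
Proof. by rewrite /sqmod addr_ge0// sqr_ge0. Qed.

Lemma recoord_sub_le x y k : `|recoord y k - recoord x k| <= cnorm (y - x).
Proof.
rewrite -sqrtr_sqr /cnorm ler_sqrt; last by apply: sumr_ge0 => i _; exact: sqmod_ge0.
rewrite (bigD1 k)//= -[leLHS]addr0 lerD//.
  rewrite /sqmod /recoord !mxE raddfB/= lerDl; exact: sqr_ge0.
by apply: sumr_ge0 => i _; exact: sqmod_ge0.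
Qed.

Lemma braket_real x z : (forall k, complex.Im (x 0 k) = 0) ->
  sqmod (braket x z) = redot (fun k => complex.Re (z 0 k)) x ^+ 2 +
                       redot (fun k => complex.Im (z 0 k)) x ^+ 2.
Proof.
move=> x_real; rewrite /sqmod /braket /redot !raddf_sum.
by congr (_ ^+ 2 + _ ^+ 2); apply: eq_bigr => k _; move: (x_real k);
  rewrite /recoord; case: (x 0 k) => a b; case: (z 0 k) => c e /= ->; ring.
Qed.

End Coordinates.

(** * Linear structure of the set of sigmoid sums *)

Section Qset.
Variables (R : realType) (N : nat).

Lemma Qset0 : @Qset R N (fun=> 0).
Proof.
exists 0%N, (fun=> 0), (fun=> 0), (fun=> 0), (fun=> 0).
split; try by case.
by apply/funext => x; rewrite /qfun big_ord0.
Qed.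

(** The two families of parameters are concatenated; the scalar goes into the coefficients, which
    carry no sign condition. *)
Lemma Qset_lin (a : R) f g : Qset f -> Qset g -> Qset (fun x : cvec R N => a * f x + g x).
Proof.
move=> [n1 [z1 [a1 [c1 [l1 [hz1 ha1 hc1 ->]]]]]].
move=> [n2 [z2 [a2 [c2 [l2 [hz2 ha2 hc2 ->]]]]]].
pose glue (A : Type) (u : 'I_n1 -> A) (v : 'I_n2 -> A) (j : 'I_(n1 + n2)) :=
  match fintype.split j with inl i => u i | inr i => v i end.
have gluel (A : Type) (u : 'I_n1 -> A) v i : glue A u v (lshift n2 i) = u i.
  by rewrite /glue (unsplitK (inl i)).
have gluer (A : Type) (u : 'I_n1 -> A) v i : glue A u v (rshift n1 i) = v i.
  by rewrite /glue (unsplitK (inr i)).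
exists (n1 + n2)%N, (glue _ z1 z2), (glue _ a1 a2), (glue _ c1 c2),
  (glue _ (fun i => a * l1 i) l2).
split=> [j|j|j|]; try by rewrite /glue; case: fintype.split.
apply/funext => x; rewrite /qfun big_split_ord /= mulr_sumr.
by congr (_ + _); apply: eq_bigr => i _; rewrite ?gluel ?gluer ?mulrA.
Qed.

Lemma Qset_sigmoid (z : cvec R N) (a c : R) : usphere z -> 0 < a -> 0 <= c <= 1 ->
  Qset (fun x => sigmoid (a * (sqmod (braket x z) - c))).
Proof.
move=> hz ha hc; exists 1%N, (fun=> z), (fun=> a), (fun=> c), (fun=> 1).
by split => //; apply/funext => x; rewrite /qfun big_ord1 mul1r.
Qed.

End Qset.

(** * From sigmoid sums to cosines *)

Section RealHemisphere.
Variables (R : realType) (N : nat) (D : set (cvec R N)) (p : 'I_N).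
Hypothesis D_real : forall x, D x -> forall k, complex.Im (x 0 k) = 0.
Hypothesis D_unit : forall x, D x -> \sum_k recoord x k ^+ 2 = 1.
Hypothesis D_pos : forall x, D x -> 0 < recoord x p.
Implicit Types (x y : cvec R N) (w : 'I_N -> R).

Lemma recoord_le1 x k : D x -> `|recoord x k| <= 1.
Proof.
move=> Dx; rewrite -(@expr_le1 _ 2)// real_normK ?num_real// -(D_unit Dx).
by rewrite (bigD1 k)//= lerDl; apply: sumr_ge0 => i _; exact: sqr_ge0.
Qed.

Lemma redot_le w x : D x -> `|redot w x| <= \sum_k `|w k|.
Proof.
move=> Dx; apply: (le_trans (ler_norm_sum _ _ _)); apply: ler_sum => k _.
by rewrite normrM ler_piMr// recoord_le1.
Qed.

(** Cauchy-Schwarz: with [u] the inner product, the squared norm of [x - u w] equals [1 - u ^+ 2].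
    The argument of the step functions thus lies in [[0, 1]]. *)
Lemma redot_sqr_le1 w x : \sum_k w k ^+ 2 = 1 -> D x -> 0 <= redot w x ^+ 2 <= 1.
Proof.
move=> w1 Dx; rewrite sqr_ge0 /=.
have : redot w x = \sum_k w k * recoord x k by [].
move: (redot w x) => u hu.
have : 0 <= \sum_k (recoord x k - u * w k) ^+ 2.
  by apply: sumr_ge0 => k _; exact: sqr_ge0.
have -> : \sum_k (recoord x k - u * w k) ^+ 2 =
   \sum_k recoord x k ^+ 2 + u ^+ 2 * (\sum_k w k ^+ 2) -
     2 * u * (\sum_k w k * recoord x k).
  rewrite !mulr_sumr -sumrN -!big_split /=.
  by apply: eq_bigr => k _; ring.
rewrite -hu w1 (D_unit Dx); nra.
Qed.

Definition cvec_of_real w : cvec R N := \row_k (Complex (w k) 0).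

Lemma usphere_of_real w : \sum_k w k ^+ 2 = 1 -> usphere (cvec_of_real w).
Proof.
move=> w1; rewrite /usphere /= /cnorm.
under eq_bigr do rewrite /sqmod mxE /= expr0n addr0.
by rewrite w1 sqrtr1.
Qed.

Lemma sqmod_braket_of_real w x : D x ->
  sqmod (braket x (cvec_of_real w)) = redot w x ^+ 2.
Proof.
move=> Dx; rewrite (braket_real _ (D_real Dx)).
have -> : redot (fun k => complex.Im (cvec_of_real w 0 k)) x = 0.
  by rewrite /redot big1// => k _; rewrite mxE mul0r.
rewrite expr0n addr0; congr (_ ^+ 2).
by apply: eq_bigr => k _; rewrite mxE.
Qed.

Local Notation bpcQ := (bpclosure D (@Qset R N)).

Lemma bpcQ_cst1 : bpcQ (fun=> 1).
Proof.
have u1 : \sum_(k < N) ((k == p)%:R : R) ^+ 2 = 1.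
  by under eq_bigr do rewrite expr2; rewrite sum_delta eqxx.
pose z := cvec_of_real (fun k => (k == p)%:R).
have := @bpc_lim _ _ D (@Qset R N)
  (fun k x => sigmoid (k.+1%:R^-1 * (sqmod (braket x z) - 0))) (fun=> 2^-1) 1.
have -> : (fun=> 1) = (fun x : cvec R N => 2 * 2^-1 : R) by rewrite divff.
move=> H; apply: bpc_scale; apply: H => [k|k x _|x _].
- by apply/bpc_base/Qset_sigmoid; [exact: usphere_of_real|rewrite invr_gt0|lra].
- by rewrite ger0_norm ?sigmoid_ge0// sigmoid_le1.
- exact: cvg_sigmoid_half.
Qed.

Lemma bpcQ_step w c : \sum_k w k ^+ 2 = 1 -> 0 <= c <= 1 ->
  bpcQ (fun x => step (redot w x ^+ 2 - c)).
Proof.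
move=> w1 c01; apply: (@bpc_lim _ _ D _
  (fun k x => sigmoid (k.+1%:R * (sqmod (braket x (cvec_of_real w)) - c))) _ 1).
- by move=> k; apply/bpc_base/Qset_sigmoid => //; exact: usphere_of_real.
- by move=> k x _; rewrite ger0_norm ?sigmoid_ge0// sigmoid_le1.
- move=> x Dx; rewrite sqmod_braket_of_real//; exact: cvg_sigmoid_step.
Qed.

Lemma bpcQ_cos_unit w s : \sum_k w k ^+ 2 = 1 -> bpcQ (fun x => cos (s * redot w x)).
Proof.
(* Since the cosine is even, [cos (s * redot w x)] depends only on the square of [redot w x], and
   [phi] is this dependence. *)
move=> w1; pose phi t : R := cos (s * Num.sqrt t).
have phiE x : phi (redot w x ^+ 2) = cos (s * redot w x).
  by rewrite /phi sqrtr_sqr -cos_norm normrM normr_id -normrM cos_norm.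
pose L := s ^+ 2 / 2.
have L0 : 0 <= L by rewrite divr_ge0// sqr_ge0.
have lip a b : 0 <= a <= 1 -> 0 <= b <= 1 -> `|phi a - phi b| <= L * `|a - b|.
  move=> /andP[a0 _] /andP[b0 _]; apply: (le_trans (cos_sqr_lipschitz _ _)).
  rewrite !exprMn !sqr_sqrtr// -mulrBr normrM (ger0_norm (sqr_ge0 s)).
  by rewrite /L mulrAC.
pose u m x := phi 0 + \sum_(i < m.+1) (phi (i.+1%:R / m.+1%:R) - phi (i%:R / m.+1%:R)) *
     step (redot w x ^+ 2 - i.+1%:R / m.+1%:R).
have uphi m x : D x -> `|u m x - cos (s * redot w x)| <= L * m.+1%:R^-1.
  by move=> Dx; rewrite -phiE; apply: step_approx => //; exact: redot_sqr_le1.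
apply: (@bpc_lim _ _ D _ u _ (L + 1)).
- move=> m; apply: bpc_add.
    by have := bpc_scale (phi 0) bpcQ_cst1; under eq_fun do rewrite mulr1.
  apply: bpc_sum => i; apply: bpc_scale; apply: bpcQ_step => //.
  by rewrite divr_ge0//= ler_pdivrMr// mul1r ler_nat ltn_ord.
- move=> m x Dx; rewrite -(subrK (cos (s * redot w x)) (u m x)).
  apply: (le_trans (ler_normD _ _)); apply: lerD; last exact: cos_max.
  apply: (le_trans (uphi m x Dx)); rewrite ler_piMr// invf_le1//.
  by rewrite ler1n.
- by move=> x Dx; apply: cvg_harmonic_bound => k; exact: uphi.
Qed.

(** A nonzero [w] is normalised and its norm becomes the frequency; [w = 0] gives the constant
    [1]. *)
Lemma bpcQ_cos w : bpcQ (fun x => cos (redot w x)).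
Proof.
pose s := Num.sqrt (\sum_k w k ^+ 2).
have sum0 : 0 <= \sum_k w k ^+ 2 by apply: sumr_ge0 => k _; exact: sqr_ge0.
have [s0|s0] := eqVneq s 0.
  have w0 k : w k = 0.
    apply/eqP; rewrite -sqrf_eq0; apply/eqP.
    have /eqP : \sum_k w k ^+ 2 = 0 by rewrite -(sqr_sqrtr sum0) -/s s0 expr0n.
    rewrite psumr_eq0 => [/allP/(_ k)|i _]; last exact: sqr_ge0.
    by rewrite mem_index_enum => /(_ isT)/eqP.
  have := bpcQ_cst1; congr (bpcQ _); apply/funext => x.
  by rewrite /redot big1 ?cos0// => k _; rewrite w0 mul0r.
have -> : (fun x => cos (redot w x)) =
    (fun x => cos (s * redot (fun k => s^-1 * w k) x)).
  by apply/funext => x; rewrite redotZ mulrA divff// mul1r.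
apply: bpcQ_cos_unit; under eq_bigr do rewrite exprMn.
by rewrite -mulr_sumr -(sqr_sqrtr sum0) -/s -exprMn mulVf// expr1n.
Qed.

(** * The algebra generated by cosines and its Borel sets *)

Definition cosines : set (cvec R N -> R) :=
  [set f | exists w, f = fun x => cos (redot w x)].

Local Notation bpcC := (bpclosure D cosines).

Lemma cosines_bounded f : cosines f -> exists M, forall x, D x -> `|f x| <= M.
Proof. by move=> [w ->]; exists 1 => x _; exact: cos_max. Qed.

Lemma cosines_cst1 : bpcC (fun=> 1).
Proof.
apply: bpc_base; exists (fun=> 0); apply/funext => x.
by rewrite /redot big1 ?cos0// => k _; rewrite mul0r.
Qed.

Lemma cosines_mul f g : cosines f -> cosines g -> bpcC (fun x => f x * g x).
Proof.
move=> [v ->] [w ->].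
have -> : (fun x => cos (redot v x) * cos (redot w x)) = (fun x =>
   2^-1 * cos (redot (fun k => v k + w k) x) +
   2^-1 * cos (redot (fun k => v k + (-1) * w k) x)).
  by apply/funext => x; rewrite !redotD redotZ mulN1r cosB cosD; field.
by apply: bpc_add; apply: bpc_scale; apply: bpc_base; eexists.
Qed.

(** [sqr_from_cos_bound] is applied with [e = 1 / (k + 1)]; on [D] the inner product is at most [V],
    which makes the error uniform. *)
Lemma bpcC_redot_sqr w : bpcC (fun x => redot w x ^+ 2).
Proof.
pose V := \sum_k `|w k|.
have V0 : 0 <= V by apply: sumr_ge0.
pose e k : R := k.+1%:R^-1.
have e0 k : 0 < e k by rewrite invr_gt0.
have e1 k : e k <= 1 by rewrite invf_le1// ler1n.
pose u k x := 2 * e k ^- 2 * (1 - cos (e k * redot w x)).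
have uw k x : D x -> `|u k x - redot w x ^+ 2| <= V ^+ 4 * k.+1%:R^-1.
  move=> Dx; apply: (le_trans (sqr_from_cos_bound _ (e0 k) (e1 k))).
  by rewrite ler_wpM2r ?invr_ge0// ler_pXn2r ?nnegrE ?redot_le.
apply: (@bpc_lim _ _ D _ u _ (V ^+ 4 + V ^+ 2)).
- move=> k; apply: bpc_scale; apply: bpc_sub; first exact: cosines_cst1.
  by apply: bpc_base; exists (fun i => e k * w i); apply/funext => x; rewrite redotZ.
- move=> k x Dx; rewrite -(subrK (redot w x ^+ 2) (u k x)).
  apply: (le_trans (ler_normD _ _)); apply: lerD.
    by apply: (le_trans (uw k x Dx)); rewrite ler_piMr ?exprn_ge0// e1.
  by rewrite normrX ler_pXn2r ?nnegrE ?redot_le.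
- by move=> x Dx; apply: cvg_harmonic_bound => k; exact: uw.
Qed.

(** Polarisation of the squares of [x_i + x_j] and [x_i - x_j]. *)
Lemma bpcC_coord_mul i j : bpcC (fun x => recoord x i * recoord x j).
Proof.
have -> : (fun x => recoord x i * recoord x j) = (fun x =>
   4^-1 * (redot (fun k => (k == i)%:R + (k == j)%:R) x ^+ 2 -
     redot (fun k => (k == i)%:R + (-1) * (k == j)%:R) x ^+ 2)).
  by apply/funext => x; rewrite !redotD redotZ !redot_delta; field.
by apply: bpc_scale; apply: bpc_sub; exact: bpcC_redot_sqr.
Qed.

(* [q] is a centre in the space of matrices, where [x] is seen as [x x^T]:
   even functions of [x] only see this rank-one projector. *)
Definition projdist (q : 'I_N * 'I_N -> R) x : R :=
  \sum_ij (recoord x ij.1 * recoord x ij.2 - q ij) ^+ 2.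

Lemma bpcC_projdist q : bpcC (projdist q).
Proof.
apply: bpc_sum => ij; apply: bpc_exp; [exact: cosines_bounded|exact: cosines_cst1|
  exact: cosines_mul|].
apply: bpc_sub; [exact: bpcC_coord_mul|exact: bpc_cst cosines_cst1 _].
Qed.

(* [|x - y|^2 |x + y|^2 = 4 - 4 <x, y>^2 = 2 |x x^T - y y^T|^2] for unit vectors,
   and [|x + y| >= x_p] as both have a positive coordinate [p]. *)
Lemma cnorm_sub_le_projdist x y : D x -> D y ->
  cnorm (y - x) ^+ 2 * recoord x p ^+ 2 <=
    2 * projdist (fun ij => recoord x ij.1 * recoord x ij.2) y.
Proof.
move=> Dx Dy; pose s := \sum_k recoord x k * recoord y k.
(* The values [-1] and [1] of [a] give the squared norms of [y - x] and [y + x]. *)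
have sq_pm (a : R) : a ^+ 2 = 1 ->
    \sum_k (recoord y k + a * recoord x k) ^+ 2 = 2 + a * (2 * s).
  move=> a1; have -> : 2 + a * (2 * s) =
      \sum_k recoord y k ^+ 2 + a ^+ 2 * (\sum_k recoord x k ^+ 2) + a * (2 * s).
    by rewrite !D_unit// a1; ring.
  rewrite /s !mulr_sumr -!big_split /=.
  by apply: eq_bigr => k _; ring.
have -> : cnorm (y - x) ^+ 2 = 2 - 2 * s.
  rewrite sqr_sqrtr; last by apply: sumr_ge0 => k _; exact: sqmod_ge0.
  rewrite -mulN1r -sq_pm ?sqrrN ?expr1n//; apply: eq_bigr => k _.
  rewrite /sqmod !mxE !raddfB /= !D_real// subrr expr0n addr0 mulN1r.
  by [].
have -> : projdist (fun ij => recoord x ij.1 * recoord x ij.2) y = 2 - 2 * s ^+ 2.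
  have dbl (f g : 'I_N -> R) :
      \sum_(ij : 'I_N * 'I_N) f ij.1 * g ij.2 = (\sum_i f i) * (\sum_j g j).
    rewrite -(pair_bigA _ (fun i j => f i * g j)) /= mulr_suml.
    by apply: eq_bigr => i _; rewrite mulr_sumr.
  have -> : 2 - 2 * s ^+ 2 =
      (\sum_k recoord y k ^+ 2) * (\sum_k recoord y k ^+ 2) +
      (\sum_k recoord x k ^+ 2) * (\sum_k recoord x k ^+ 2) - 2 * (s * s).
    by rewrite !D_unit//; ring.
  rewrite -!dbl mulr_sumr -sumrN -!big_split /=.
  by apply: eq_bigr => ij _; ring.
have xp : recoord x p ^+ 2 <= 2 + 2 * s.
  have := sq_pm 1 (expr1n _ _); rewrite mul1r => <-.
  rewrite (bigD1 p)//= mul1r ler_wpDr//.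
    by apply: sumr_ge0 => i _; exact: sqr_ge0.
  have xp0 := D_pos Dx; have yp0 := D_pos Dy; rewrite ler_pXn2r ?nnegrE //; lra.
have s1 : 0 <= 2 - 2 * s.
  rewrite -mulN1r -sq_pm ?sqrrN ?expr1n//.
  by apply: sumr_ge0 => i _; exact: sqr_ge0.
have := ler_wpM2l s1 xp; nra.
Qed.

Lemma projdist_triangle q x y :
  projdist (fun ij => recoord x ij.1 * recoord x ij.2) y <=
    2 * (projdist q x + projdist q y).
Proof.
rewrite /projdist -big_split mulr_sumr; apply: ler_sum => ij _ /=.
have := sqr_ge0 ((recoord x ij.1 * recoord x ij.2 - q ij) +
  (recoord y ij.1 * recoord y ij.2 - q ij)); nra.
Qed.

Lemma projdist_rat x (e : R) : 0 < e ->
  exists q : {ffun 'I_N * 'I_N -> rat}, projdist (fun ij => ratr (q ij)) x < e.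
Proof.
move=> e0; pose n := #|{: 'I_N * 'I_N}|.
(* The bound [1] makes the square of an error below [dl] at most [dl]; dividing by [n.+1] rather
   than [n] makes the total strictly less than [e]. *)
pose dl := Num.min 1 (e / n.+1%:R).
have d0 : 0 < dl by rewrite lt_min ltr01 divr_gt0.
have [f hf] : exists f : 'I_N * 'I_N -> rat, forall ij,
    `|recoord x ij.1 * recoord x ij.2 - ratr (f ij)| < dl.
  apply: (@fin_all_exists _ (fun=> rat) (fun ij r =>
    `|recoord x ij.1 * recoord x ij.2 - ratr r| < dl)) => ij.
  move: (recoord x ij.1 * recoord x ij.2) => a.
  have /rat_in_itvoo[q] : a - dl < a + dl by lra.
  by rewrite in_itv /= => hq; exists q; rewrite ltr_norml; lra.
exists [ffun ij => f ij]; apply: (@le_lt_trans _ _ (\sum_(ij : 'I_N * 'I_N) dl)).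
  apply: ler_sum => ij _; rewrite ffunE -[leLHS]real_normK ?num_real//.
  have := hf ij; set t := `| _ | => h.
  have t0 : 0 <= t by exact: normr_ge0.
  have d1 : dl <= 1 by rewrite ge_min lexx.
  nra.
rewrite sumr_const -/n -mulr_natr.
have : dl <= e / n.+1%:R by rewrite ge_min lexx orbT.
move=> h; have := ler_wpM2r (ler0n R n.+1) h; rewrite divfK ?gt_eqF//.
rewrite -natr1; lra.
Qed.

(** A second-countability argument: on [D], an open set is a countable union of [projdist] balls
    with rational centres and radii [1 / (m + 1)]. *)
Lemma bpcC_trace_opens A : trace_opens D A -> bpc_sets D cosines A.
Proof.
move=> [U oU <-].
have sa := bpc_sets_sigma_algebra cosines_bounded cosines_cst1 cosines_mul.
pose B (qm : {ffun 'I_N * 'I_N -> rat} * nat) :=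
  [set x | projdist (fun ij => ratr (qm.1 ij)) x < qm.2.+1%:R^-1].
(* Enumerates the pairs of a centre and a radius index; codes of nothing, and balls whose trace on
   [D] leaves [U], yield the empty set. *)
pose F i := if unpickle i is Some qm then
  if `[< D `&` B qm `<=` U >] then B qm else set0 else set0.
have HF : bpc_sets D cosines (\bigcup_i F i).
  case: sa => s0 _; apply => i; rewrite /F; case: unpickle => // qm.
  case: ifP => // _; apply: bpc_lt_indic; [exact: cosines_bounded|exact: cosines_cst1|
    exact: cosines_mul|exact: bpcC_projdist].
apply: (bpc_eq HF); last first.
  by exists 1 => x _; rewrite indicE; case: (_ \in _); rewrite ?normr1 ?normr0.
move=> x Dx; rewrite !indicE; congr (nat_of_bool _)%:R.
apply/idP/idP; rewrite !inE.
  move=> [i _]; rewrite /F; case: unpickle => // qm; case: asboolP => // sub Bx.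
  by split => //; exact: sub.
move=> [_ Ux]; have [e e0 he] := oU _ Ux.
have xp0 := D_pos Dx.
(* The [8] is the product of [2] from [cnorm_sub_le_projdist], [2] from [projdist_triangle], and [2]
   for the two distances to the centre. *)
have ex0 : 0 < e ^+ 2 * recoord x p ^+ 2 / 8 by rewrite divr_gt0// mulr_gt0// exprn_gt0.
have [m hm] : exists m, m.+1%:R^-1 < e ^+ 2 * recoord x p ^+ 2 / 8.
  have := @cvg_harmonic R => /cvgrPdist_lt/(_ _ ex0)[m _ /(_ m (leqnn _))].
  by rewrite /= sub0r normrN => h; exists m; apply: le_lt_trans h; exact: ler_norm.
have m0 : 0 < m.+1%:R^-1 :> R by rewrite invr_gt0.
have [q hq] := projdist_rat x m0.
exists (pickle (q, m)) => //; rewrite /F pickleK; case: asboolP => // -[] y [Dy By].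
apply: he; rewrite -(@ltr_pXn2r _ 2)// ?nnegrE ?sqrtr_ge0// ?ltW//.
rewrite -(@ltr_pM2r _ (recoord x p ^+ 2)) ?exprn_gt0//.
apply: (le_lt_trans (cnorm_sub_le_projdist Dx Dy)).
have qy : projdist (fun ij => ratr (q ij)) y < m.+1%:R^-1 := By.
have := projdist_triangle (fun ij => ratr (q ij)) x y.
move: hm hq qy; move: m.+1%:R^-1 (projdist _ x) (projdist _ y) (projdist _ y).
by move=> a b c b' *; lra.
Qed.

(** * Measurability and density on the hemisphere *)

Lemma bpcC_measurable (A : set (borel_on D)) : measurable A -> bpc_sets D cosines A.
Proof.
have sa := bpc_sets_sigma_algebra cosines_bounded cosines_cst1 cosines_mul.
by apply: (smallest_sub sa); exact: bpcC_trace_opens.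
Qed.

Lemma measurable_borel_on : measurable (D : set (borel_on D)).
Proof.
apply: sub_sigma_algebra; exists setT; last by rewrite setIT.
by move=> x _; exists 1.
Qed.

Lemma measurable_recoord k :
  measurable_fun (D : set (borel_on D)) (fun x => recoord x k).
Proof.
apply: (measurability _ (RGenOInfty.measurableE R)) => _ [_ [a ->] <-].
apply: sub_sigma_algebra; exists [set x | a < recoord x k].
  move=> x /= ax; exists (recoord x k - a); first by rewrite subr_gt0.
  move=> y /(le_lt_trans (recoord_sub_le x y k)); rewrite ltr_norml; lra.
by congr (_ `&` _); apply/seteqP; split=> x /=; rewrite in_itv /= andbT.
Qed.

Lemma measurable_Qset q : Qset q -> measurable_fun (D : set (borel_on D)) q.
Proof.
move=> [ns [z [a [c [l [_ _ _ ->]]]]]].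
have mdot w : measurable_fun (D : set (borel_on D)) (fun x => redot w x).
  apply: measurable_sum => k; apply: measurable_funM => //.
  exact: measurable_recoord.
apply: measurable_sum => j; apply: measurable_funM => //.
have msig : measurable_fun setT (@sigmoid R).
  apply: continuous_measurable_fun => t; rewrite /sigmoid.
  apply: cvgM; first exact: cvg_cst.
  apply: cvgV; first by rewrite gt_eqF// addr_gt0// expR_gt0.
  apply: cvgD; first exact: cvg_cst.
  apply: continuous_comp; [exact: opp_continuous|exact: continuous_expR].
apply: (measurableT_comp msig); apply: measurable_funM => //.
apply: measurable_funB => //.
(* The vectors [z j] are complex in general; since [x] is real on [D], the squared modulus is a
   polynomial in the real coordinates of [x]. *)
apply: (@eq_measurable_fun _ _ (borel_on D) R D (fun x =>
  redot (fun k => complex.Re (z j 0 k)) x ^+ 2 +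
  redot (fun k => complex.Im (z j 0 k)) x ^+ 2)).
  by move=> x /set_mem Dx; rewrite braket_real//; exact: D_real.
by apply: measurable_funD; apply: measurable_funX; exact: mdot.
Qed.

Lemma Qset_dense (mu : {finite_measure set (borel_on D) -> \bar R})
  (f : borel_on D -> R) :
  measurable_fun (D : set (borel_on D)) f ->
  mu.-integrable D (fun x => (f x ^+ 2)%:E) ->
  forall eps : R, 0 < eps -> exists2 q, Qset q &
    (\int[mu]_(x in D) ((q x - f x) ^+ 2)%:E < eps%:E)%E.
Proof.
move=> mf if2; have [] // := @L2closure_all _ (borel_on D) R mu D
  measurable_borel_on (@Qset R N) measurable_Qset (@Qset0 R N)
  (@Qset_lin R N) _ f mf if2.
(* Indicators of Borel sets lie in the closure of the cosines, and every cosine lies in the closure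
   of [Qset]. *)
move=> A /bpcC_measurable; apply: bpc_sub_closure => _ [w ->].
exact: bpcQ_cos.
Qed.

End RealHemisphere.

(** * The amplitude encoding *)

Section AmplitudeEncoding.
Variables (R : realType) (d n : nat) (x : 'rV[R]_d).
Hypothesis dn : (d < 2 ^ n)%N.
Hypothesis x_gt0 : 0 < rnorm x.

Lemma xtilde_gt0 : 0 < xtilde x.
Proof. by rewrite /xtilde divr_gt0// addr_gt0. Qed.

Lemma gammaenc_sqr : gammaenc x ^+ 2 = rnorm x ^+ 2 + xtilde x ^+ 2.
Proof. by rewrite sqr_sqrtr// addr_ge0// sqr_ge0. Qed.

Lemma gammaenc_gt0 : 0 < gammaenc x.
Proof. by rewrite sqrtr_gt0 ltr_pwDl ?exprn_gt0// sqr_ge0. Qed.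

Lemma Im_amp_enc k : complex.Im (amp_enc n x 0 k) = 0.
Proof. by rewrite mxE. Qed.

Lemma recoord_amp_enc_gt0 : 0 < recoord (amp_enc n x) (Ordinal dn).
Proof.
rewrite /recoord mxE /= insubF ?ltnn// eqxx.
by rewrite divr_gt0 ?xtilde_gt0 ?gammaenc_gt0.
Qed.

Lemma recoord_amp_enc_unit : \sum_k recoord (amp_enc n x) k ^+ 2 = 1.
Proof.
(* The encoding before normalisation, extended to all naturals so that the sum can be cut at index
   [d]: the coordinates of [x], then [xtilde x], then zeros. *)
pose F (m : nat) : R := if @insub nat (fun m => (m < d)%N) 'I_d m is Some i then x 0 i
      else if m == d then xtilde x else 0.
have g0 : gammaenc x ^+ 2 != 0 by rewrite gt_eqF// exprn_gt0// gammaenc_gt0.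
rewrite (eq_bigr (fun k : 'I__ => F k ^+ 2 / gammaenc x ^+ 2)); last first.
  by move=> k _; rewrite /recoord mxE /= expr_div_n.
rewrite -mulr_suml; apply: (mulIf g0); rewrite divfK// mul1r gammaenc_sqr.
rewrite -(big_mkord xpredT (fun k => F k ^+ 2)).
rewrite (@big_cat_nat _ _ _ d)//=; last exact: ltnW.
have tail0 : \sum_(d.+1 <= k < 2 ^ n) F k ^+ 2 = 0.
  rewrite big_nat_cond big1// => k; rewrite andbT => /andP[dk _].
  by rewrite /F insubF ?gtn_eqF ?expr0n// ltnNge ltnW.
rewrite (@big_ltn _ _ _ d)// tail0 addr0 {2}/F insubF ?ltnn// eqxx; congr (_ + _).
rewrite sqr_sqrtr; last by apply: sumr_ge0 => i _; exact: sqr_ge0.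
by rewrite big_mkord; apply: eq_bigr => i _; rewrite /F valK.
Qed.

End AmplitudeEncoding.

Theorem theorem1 (R : realType) (d n : nat) (k1 k2 : R)
  (G : set 'rV[R]_d)
  (mu : {finite_measure set (Gspace n G) -> \bar R})
  (f : Gspace n G -> R) :
  (0 < d)%N -> (0 < n)%N -> (d.+1 <= 2 ^ n)%N ->
  0 < k1 -> k1 <= k2 ->
  (forall x, G x -> k1 <= rnorm x <= k2) ->
  measurable_fun (GbarS n G) f ->
  mu.-integrable (GbarS n G) (fun x => (f x ^+ 2)%:E) ->
  forall eps : R, 0 < eps ->
  exists2 q, Qset q &
    (\int[mu]_(x in GbarS n G) ((q x - f x) ^+ 2)%:E < eps%:E)%E.
Proof.
move=> _ _ dn k1_gt0 _ G_bound mf if2.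
have G_gt0 x : G x -> 0 < rnorm x.
  by move=> /G_bound/andP[kx _]; exact: lt_le_trans kx.
(* The coordinate of index [d] holds [xtilde x / gammaenc x], which is positive because [k1] keeps
   [x] away from [0]. *)
apply: (@Qset_dense R _ (Gbar n G) (Ordinal dn)) => //.
- by move=> _ [x _ <-] k; exact: Im_amp_enc.
- by move=> _ [x Gx <-]; apply: recoord_amp_enc_unit => //; exact: G_gt0.
- by move=> _ [x Gx <-]; apply: recoord_amp_enc_gt0; exact: G_gt0.
Qed.
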